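(* Let $\mathfrak M=(\mathcal M,\rho)$ be a pseudometric space, and let $F:\mathcal M\to\mathrm{Conv}(\mathbf R^2)$ be a set-valued mapping. Suppose that either $\mathcal M$ is finite or there exist a constant $\alpha\ge0$ and elements $\bar x_1,\dots,\bar x_m\in\mathcal M$ such that the set $\bigcap\{F(\bar x_k)+\alpha Q_0:k=1,\dots,m\}$ is non-empty and bounded. Then $F$ has a Lipschitz selection if and only if there exists a constant $\lambda\ge0$ such that for every $x,x',x'',y,y',y''\in\mathcal M$ $$\mathcal W_F[x,x',x'':\lambda]\cap\{\mathcal W_F[y,y',y'':\lambda]+\lambda\,\rho(x,y)\,Q_0\}\ne\emptyset.$$ Furthermore, $\inf\lambda\le|F|_{\mathfrak M}\le3\inf\lambda$, where the infimum is over all such $\lambda$.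
   Context: A pseudometric space $\mathfrak M=(\mathcal M,\rho)$ is a set with $\rho:\mathcal M\times\mathcal M\to[0,+\infty]$ such that $\rho(x,x)=0$, $\rho(x,y)=\rho(y,x)$, $\rho(x,y)\le\rho(x,z)+\rho(z,y)$; $\rho(x,y)=0$ with $x\ne y$ and $\rho(x,y)=+\infty$ are allowed. We read $\lambda\cdot(+\infty)=+\infty$ for every $\lambda\ge0$ and $(+\infty)Q_0=\mathbf R^2$. $\mathbf R^2$ carries the uniform norm $\|x\|=\max\{|x_1|,|x_2|\}$; $Q_0=[-1,1]^2$; sums of sets are Minkowski sums. $\mathrm{Conv}(\mathbf R^2)$ is the family of all non-empty convex closed subsets of $\mathbf R^2$. For $f:\mathcal M\to\mathbf R^2$, $\|f\|_{\mathrm{Lip}(\mathcal M)}=\inf\{\lambda\ge0:\|f(x)-f(y)\|\le\lambda\rho(x,y)\ \forall x,y\in\mathcal M\}$ ($\inf\emptyset=+\infty$); $f$ is Lipschitz if this is finite. A selection of $F$ is a map $f:\mathcal M\to\mathbf R^2$ with $f(x)\in F(x)$ for all $x$. $|F|_{\mathfrak M}$ is the infimum of $\|f\|_{\mathrm{Lip}(\mathcal M)}$ over all Lipschitz selections $f$ of $F$, and $+\infty$ if there are none. For a convex set $S\subset\mathbf R^2$, the rectangular hull $\mathcal H[S]$ is the smallest rectangle (product of two intervals, possibly unbounded and not necessarily closed, sides parallel to the coordinate axes) containing $S$; equivalently the product of the orthogonal projections of $S$ onto the two coordinate axes ($\mathcal H[\emptyset]=\emptyset$). For $x,x',x''\in\mathcal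 M$, $\lambda\ge0$, $$\mathcal W_F[x,x',x'':\lambda]=\mathcal H[\{F(x')+\lambda\,\rho(x',x)Q_0\}\cap\{F(x'')+\lambda\,\rho(x'',x)Q_0\}].$$
   Formalization: In the second alternative (non-empty bounded intersection) ρ is additionally required to be finite-valued; as stated, with ρ=+∞ allowed, the claim fails (F={0} at one point at infinite distance from ℕ with ρ=0 and F(n)=[n,∞)×R). *)

(* Defs.v *)
From HB Require Import structures.
From mathcomp Require Import all_boot all_order all_algebra.
From mathcomp Require Import all_classical all_reals all_analysis.
From mathcomp Require Import ring lra.

Set Implicit Arguments.
Unset Strict Implicit.
Unset Printing Implicit Defensive.

Import Order.TTheory GRing.Theory Num.Theory.
Import numFieldNormedType.Exports.

Local Open Scope classical_set_scope.
Local Open Scope ring_scope.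

(* The norm of a product of normed modules is the maximum of the norms of the
   components, so the library norm on the plane is the uniform norm; see
   [norm_planeE]. *)
Notation plane R := (R^o * R^o)%type.

Record is_pseudometric (R : realType) (M : Type) (rho : M -> M -> \bar R) :
    Prop := IsPseudometric {
  pseudometric_ge0 : forall x y, (0 <= rho x y)%E;
  pseudometric_refl : forall x, rho x x = 0%E;
  pseudometric_sym : forall x y, rho x y = rho y x;
  pseudometric_triangle : forall x y z, (rho x y <= rho x z + rho z y)%E }.

(* The product lam * t, with the convention lam * +oo = +oo even for lam = 0
   (whereas 0 * +oo = 0 in \bar R). *)
Definition escale (R : realType) (lam : R) (t : \bar R) : \bar R :=
  if t == +oo%E then +oo%E else (lam%:E * t)%E.

Definition Q0 (R : realType) : set (plane R) :=
  [set` `[(-1 : R), 1]] `*` [set` `[(-1 : R), 1]].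

(* The set t Q0 for t in [0, +oo]; the value at -oo is junk. *)
Definition scaleQ0 (R : realType) (t : \bar R) : set (plane R) :=
  match t with
  | r%:E => [set (r *: q : plane R) | q in @Q0 R]
  | +oo => setT
  | -oo => set0
  end%E.

Definition minkowski_sum (R : realType) (A B : set (plane R)) :
    set (plane R) :=
  [set (a + b : plane R) | a in A & b in B].

Definition Conv (R : realType) : set (set (plane R)) :=
  [set A : set (plane R) | [/\ A !=set0, convex_set A & closed A]].

(* [is_interval] is order-convexity; over a realType, these sets are exactly
   the intervals of all kinds: empty, open or closed at either end, bounded or
   not. *)
Definition rectangle (R : realType) : set (set (plane R)) :=
  [set A | exists I J : set R,
     [/\ is_interval I, is_interval J & A = I `*` J]].

Definition rect_hull (R : realType) (S : set (plane R)) : set (plane R) :=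
  smallest (@rectangle R) S.

Section LipschitzSelections.
Variables (R : realType) (M : Type) (rho : M -> M -> \bar R).

Definition lip_seminorm (f : M -> plane R) : \bar R :=
  ereal_inf [set lam%:E | lam in
    [set lam : R | 0 <= lam /\
       forall x y, (`|f x - f y|%:E <= escale lam (rho x y))%E]].

Definition is_Lipschitz (f : M -> plane R) : Prop :=
  (lip_seminorm f < +oo)%E.

Definition is_selection (F : M -> set (plane R)) (f : M -> plane R) : Prop :=
  forall x, F x (f x).

Definition selection_norm (F : M -> set (plane R)) : \bar R :=
  ereal_inf [set lip_seminorm f | f in
    [set f | is_Lipschitz f /\ is_selection F f]].

Definition W (F : M -> set (plane R)) (lam : R) (x x' x'' : M) :
    set (plane R) :=
  rect_hull
    (minkowski_sum (F x') (scaleQ0 (escale lam (rho x' x))) `&`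
     minkowski_sum (F x'') (scaleQ0 (escale lam (rho x'' x)))).

Definition W_condition (F : M -> set (plane R)) (lam : R) : Prop :=
  forall x x' x'' y y' y'' : M,
    W F lam x x' x'' `&`
    minkowski_sum (W F lam y y' y'') (scaleQ0 (escale lam (rho x y)))
      !=set0.

Definition bounded_intersection (F : M -> set (plane R)) : Prop :=
  exists (alpha : R) (m : nat) (xbar : 'I_m -> M),
    let A := \bigcap_(k in [set: 'I_m])
               minkowski_sum (F (xbar k)) (scaleQ0 alpha%:E) in
    [/\ 0 <= alpha, A !=set0 & bounded_set A].

End LipschitzSelections.

Lemma norm_planeE (R : realType) (x : plane R) :
  `|x| = Num.max `|x.1 : R| `|x.2 : R|.
Proof. by []. Qed.

Lemma rect_hullE (R : realType) (S : set (plane R)) :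
  convex_set S -> rect_hull S = (fst @` S) `*` (snd @` S).
Proof.
move=> cS.
have seg (p q : plane R) (pr : plane R -> R) (z : R) :
    (forall (t : R) (a b : plane R),
       pr (t *: a + (1 - t) *: b) = t * pr a + (1 - t) * pr b) ->
    S p -> S q -> pr p <= z <= pr q -> exists2 s, S s & pr s = z.
  move=> lpr Sp Sq /andP[pz zq].
  have [pq|npq] := eqVneq (pr p) (pr q).
    by exists p => //; apply/eqP; rewrite eq_le pz pq zq.
  have d0 : 0 < pr q - pr p.
    by rewrite subr_gt0 lt_neqAle npq (le_trans pz zq).
  pose t := (pr q - z) / (pr q - pr p).
  have t0 : 0 <= t by rewrite divr_ge0 ?subr_ge0 // (le_trans pz zq).
  have t1 : t <= 1 by rewrite ler_pdivrMr // mul1r lerD2l lerN2.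
  have := cS p q (Itv01 t0 t1) (mem_set Sp) (mem_set Sq).
  move=> /set_mem Ss; eexists; first exact: Ss.
  rewrite [LHS](lpr t p q) /t; field; exact: lt0r_neq0.
apply/seteqP; split.
  apply: smallest_sub; last by move=> x Sx; split; exists x.
  exists (fst @` S), (snd @` S); split => //.
    move=> _ _ [p Sp <-] [q Sq <-] z pzq.
    by have [//|s Ss sz] := seg p q fst z _ Sp Sq pzq; exists s.
  move=> _ _ [p Sp <-] [q Sq <-] z pzq.
  by have [//|s Ss sz] := seg p q snd z _ Sp Sq pzq; exists s.
move=> [x1 x2] [[p Sp px] [q Sq qx]] A [[I [J [_ _ ->]]] SIJ].
by move: px qx => /= <- <-; split => /=; [case: (SIJ _ Sp)|case: (SIJ _ Sq)].
Qed.

(* If M is infinite, [bounded_intersection] alone does not suffice when rho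
   takes the value +oo: it only constrains F on the points at finite distance
   from the xbar k.  In the example below, M consists of one point with
   F = {0}, at infinite distance from a copy of the natural numbers with
   rho = 0 and F n = [n, +oo[ x R. *)
Lemma bounded_intersection_infinite_distance (R : realType) :
  exists (M : Type) (rho : M -> M -> \bar R) (F : M -> set (plane R)),
    [/\ is_pseudometric rho, forall x, Conv (F x), bounded_intersection F,
        exists lam : R, 0 <= lam /\ W_condition rho F lam &
        ~ exists f, is_Lipschitz rho f /\ is_selection F f].
Proof.
pose rho (x y : option nat) : \bar R :=
  if isSome x == isSome y then 0%E else +oo%E.
pose F (x : option nat) : set (plane R) :=
  if x is Some n then [set p : plane R | n%:R <= p.1] else [set 0].
have Q00 : @Q0 R 0 by split; rewrite /= in_itv /= lerN10 ler01.
have rho_fin x y : rho x y != +oo%E -> rho x y = 0%E.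
  by rewrite /rho; case: ifP.
have sQ00 t : (0 <= t)%E -> @scaleQ0 R t 0.
  by case: t => [r| |] //= _; exists 0 => //; rewrite scaler0.
have esc x y : escale 0 (rho x y) = rho x y.
  by rewrite /escale; case: eqP => [->//|/eqP/rho_fin ->]; rewrite mule0.
have rho0 x y : (0 <= rho x y)%E by rewrite /rho; case: ifP.
have sub_sum (A : set (plane R)) t : (0 <= t)%E ->
    A `<=` minkowski_sum A (scaleQ0 t).
  by move=> t0 a Aa; exists a => //; exists 0; [exact: sQ00 | rewrite addr0].
have sumT (A : set (plane R)) : A !=set0 ->
    minkowski_sum A (scaleQ0 +oo%E) = setT.
  move=> [a Aa]; apply/seteqP; split => // p _.
  by exists a => //; exists (p - a) => //; rewrite addrCA subrr addr0.
pose val (x : option nat) : R := if x is Some n then n%:R else 0.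
have val0 x : 0 <= val x by case: x => //= n.
have Fne x : F x !=set0.
  by case: x => [n|]; [exists (n%:R, 0) => /= | exists 0].
(* [c x] is the point (s, 0), with s large, for x in the copy of the natural
   numbers, and 0 at the other point. *)
pose c s (x : option nat) : plane R := if x is Some _ then (s, 0) else 0.
have FW s x x' : val x' <= s ->
    minkowski_sum (F x') (scaleQ0 (escale 0 (rho x' x))) (c s x).
  move=> xs; rewrite esc; have [xx|nxx] := boolP (isSome x' == isSome x).
    apply: sub_sum; first exact: rho0.
    by case: x' x xs xx => [n|] [m|].
  by rewrite /rho (negbTE nxx) sumT.
have WW s x x' x'' : val x' <= s -> val x'' <= s ->
    W rho F 0 x x' x'' (c s x).
  by move=> h' h'' A [_]; apply; split; exact: FW.
exists (option nat), rho, F; split.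
- split.
  + exact: rho0.
  + by move=> x; rewrite /rho eqxx.
  + by move=> x y; rewrite /rho eq_sym.
  + by move=> [x|] [y|] [z|]; rewrite /rho /= ?adde0 ?leey.
- move=> x; split; first exact: Fne.
  + case: x => [n|] p q t /set_mem Fp /set_mem Fq; apply/mem_set.
      rewrite /F /= in Fp Fq *.
      have -> : n%:R = t%:num * n%:R + (1 - t%:num) * n%:R :> R by ring.
      apply: lerD; apply: ler_wpM2l => //.
    move: Fp Fq => /= -> ->.
    exact: (convmm t (0 : convex_lmodType (plane R))).
  + case: x => [n|] /=; last first.
      exact/accessible_closed_set1/hausdorff_accessible/norm_hausdorff.
    apply: (@preimage_closed (plane R) R^o fst [set y | n%:R <= y]).
      by move=> p _; exact: cvg_fst.
    exact: closed_ge.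
- exists 0, 1%N, (fun=> None).
  have -> : \bigcap_(k in [set: 'I_1])
      minkowski_sum (F None) (scaleQ0 0%:E) = [set 0].
    apply/seteqP; split => [p /(_ ord0 I)|p ->].
      by move=> [_ -> [_ [q _ <-] <-]]; rewrite scale0r addr0.
    by move=> k _; apply: sub_sum.
  split => //; first by exists 0.
  by exists 0; split => // r r0 p /= ->; rewrite normr0 ltW.
- exists 0; split => // x x' x'' y y' y''.
  pose s := val x' + val x'' + val y' + val y''.
  have [s1 s2 s3 s4] :
      [/\ val x' <= s, val x'' <= s, val y' <= s & val y'' <= s].
    have := val0 x'; have := val0 x''; have := val0 y'; have := val0 y''.
    by rewrite /s; split; lra.
  exists (c s x); split; first exact: WW.
  rewrite esc; have [xy|nxy] := boolP (isSome x == isSome y).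
    apply: sub_sum; first exact: rho0.
    have -> : c s x = c s y by case: x y xy => [m|] [n|].
    exact: WW.
  by rewrite /rho (negbTE nxy) sumT //; exists (c s y); exact: WW.
- move=> [f [/ereal_inf_lt[_ [lam [lam0 lf] <-] _] sf]].
  have fE n : f (Some n) = f (Some 0%N).
    have := lf (Some n) (Some 0%N); rewrite /escale /rho /= mule0 lee_fin.
    by rewrite normr_le0 subr_eq0 => /eqP.
  have [n nP] : exists n : nat, (f (Some 0%N)).1 < n%:R :> R.
    exists (Num.bound `|((f (Some 0%N)).1 : R)|).
    exact: le_lt_trans (ler_norm _) (archi_boundP (normr_ge0 _)).
  by have := sf (Some n); rewrite /= fE leNgt nP.
Qed.

(* Main.v *)
Require Import Defs.
From mathcomp Require Import all_boot all_order all_algebra.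
From mathcomp Require Import all_classical all_reals all_analysis.
From mathcomp Require Import finmap ring lra.

(** Necessity, with inf lambda <= |F|, is immediate: if f is a selection of F
    with Lipschitz constant lambda, then f x lies in every W[x, x', x''], and
    f y witnesses the intersection condition.

    Sufficiency and the factor 3 come from a projection construction on a
    finite domain.  Let d = lambda * rho and let
    A x = \bigcap_z (F z + d(z, x) Q0).
    - A set W is the product of the two projections of a slab
      (F x' + d(x', x) Q0) `&` (F x'' + d(x'', x) Q0), so the condition splits
      into one condition per coordinate.  In each coordinate it says that the
      intervals attached to the triples (x, x', x''), placed at x, are pairwise
      within d of each other; on the line this pairwise condition is enough
      for a selection with |g x - g y| <= d(x, y)
      ([Lipschitz_selection_line]).  The two selections form a point g x whose
      coordinates g_i x lie in the i-th projection of every slab at x.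
    - On the vertical line through g x the sets F z + d(z, x) Q0 therefore cut
      out pairwise intersecting intervals, and Helly on the line gives a point
      of A x on it; the same holds on the horizontal line.  So g x belongs to
      the rectangular hull of A x, and A x is not empty.
    - Let f x be g x if g x is in A x, and otherwise the first point of A x on
      the diagonal ray from g x into the closed quadrant that contains the
      two points of A x just found ([exists_corner]).  It is the nearest point of
      A x to g x in the uniform norm.  The point of the construction is that
      a single set F z + d(z, x) Q0 already misses the open quadrant that
      f x cuts off, with f x as its vertex and g x inside.  Since
      F z + d(z, y) Q0 is within d(x, y) of F z + d(z, x) Q0 for this one z,
      A y cannot enter that quadrant by more than d(x, y).  Comparing the two
      quadrants, with |g x - g y| <= d(x, y), gives |f x - f y| <= 3 d(x, y)
      ([corner_dist]).
    Finally f x is in F x because d(x, x) = 0.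

    When the domain is infinite, the finite case applies to all finite
    subfamilies.  If the intersection of the sets F(xbar k) + alpha Q0 is
    non-empty and bounded, it stays bounded when alpha is replaced by any
    larger radius ([bounded_thicken]), so the values at x of all finite
    selections defined at x and the xbar k stay in one compact set, and
    Tychonoff's theorem gives a selection on the whole domain. *)

Import Order.TTheory GRing.Theory Num.Theory.
Import numFieldNormedType.Exports.

Local Open Scope classical_set_scope.
Local Open Scope ring_scope.

Set Implicit Arguments.
Unset Strict Implicit.
Unset Printing Implicit Defensive.

(** * Helly's theorem and Lipschitz selections on the line *)

(** If c i j is a point of T i `&` T j, the point max_i min_j c i j works:
    each T k contains min_j c k j, which is below it, and, for the index i that
    attains the maximum, c i k, which is above it.  The intervals may be open
    or unbounded, so for infinite families this fails. *)
Lemma Helly_line (R : realType) (J : finType) (T : J -> set R) :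
  (forall j, is_interval (T j)) -> (forall i j, T i `&` T j !=set0) ->
  exists c, forall j, T j c.
Proof.
move=> intT Tpair; have [j0|J0] := pickP J; last first.
  by exists 0 => j; have := J0 j.
have [c cP] : exists c : J -> J -> R, forall i j, T i (c i j) /\ T j (c i j).
  have /choice[c cP] : forall ij : J * J, exists t, T ij.1 t /\ T ij.2 t.
    by move=> [i j]; have [t] := Tpair i j; exists t.
  by exists (fun i j => c (i, j)) => i j; exact: (cP (i, j)).
pose lo i := [arg min_(j < j0) c i j]%O.
have loP i j : c i (lo i) <= c i j by rewrite /lo; case: arg_minP => // k _; exact.
pose hi := [arg max_(i > j0) c i (lo i)]%O.
have hiP i : c i (lo i) <= c hi (lo hi).
  by rewrite /hi; case: arg_maxP => // k _; exact.
exists (c hi (lo hi)) => k.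
apply: (intT k _ _ (proj1 (cP k (lo k))) (proj2 (cP hi k))).
by rewrite hiP loP.
Qed.

Definition thicken_line (R : realType) (T : set R) (t : \bar R) : set R :=
  [set c | exists2 s, T s & (`|c - s|%:E <= t)%E].

Lemma is_interval_thicken_line (R : realType) (T : set R) (t : \bar R) :
  is_interval T -> is_interval (thicken_line T t).
Proof.
move=> intT c1 c2 [s1 T1 d1] [s2 T2 d2] z /andP[c1z zc2].
case: t d1 d2 => [r| |]; last 2 first.
- by move=> *; exists s1 => //; rewrite leey.
- by rewrite leNgt ltNyr.
rewrite !lee_fin !ler_norml => /andP[d1 d1'] /andP[d2 d2'].
have [s12|s21] := leP s1 s2; last first.
  by exists s1 => //; rewrite lee_fin ler_norml; apply/andP; split; lra.
have [zs1|s1z] := leP z s1.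
  by exists s1 => //; rewrite lee_fin ler_norml; apply/andP; split; lra.
have [zs2|s2z] := leP z s2; last first.
  by exists s2 => //; rewrite lee_fin ler_norml; apply/andP; split; lra.
exists z; first by apply: (intT _ _ T1 T2); rewrite (ltW s1z).
by rewrite lee_fin ler_norml; apply/andP; split; lra.
Qed.

Lemma line_ball_intersect (R : realType) (s t : R) (d1 d2 : \bar R) :
  (0 <= d1)%E -> (0 <= d2)%E -> (`|s - t|%:E <= d1 + d2)%E ->
  exists c, (`|c - s|%:E <= d1)%E /\ (`|c - t|%:E <= d2)%E.
Proof.
case: d1 => [d1| |] //; case: d2 => [d2| |] //.
- rewrite !lee_fin => d10 d20; rewrite ler_norml => /andP[l1 l2].
  exists (Num.max (s - d1) (t - d2)).
  by rewrite !lee_fin !ler_norml !lerBrDr !lerBlDr !le_max !ge_max;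
    split; apply/andP; split; first [apply/orP|apply/andP]; lra.
- by move=> d10 _ _; exists s; rewrite subrr normr0 leey.
- by move=> _ d20 _; exists t; rewrite subrr normr0 leey.
- by move=> _ _ _; exists s; rewrite !leey.
Qed.

(** The intervals are shrunk to single points one at a time, keeping the
    pairwise condition.  To shrink T j0, take a point within d j0 k of T k for
    every k; it exists by Helly because the triangle inequality makes the
    neighbourhoods of radius d j0 k of the T k intersect pairwise. *)
Lemma Lipschitz_selection_line (R : realType) (J : finType)
    (d : J -> J -> \bar R) (T : J -> set R) :
  is_pseudometric d -> (forall j, is_interval (T j)) ->
  (forall i j, T i `&` thicken_line (T j) (d i j) !=set0) ->
  exists g : J -> R, (forall j, T j (g j)) /\
    forall i j, (`|g i - g j|%:E <= d i j)%E.
Proof.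
move=> [d0 drefl dsym dtri] intT Tpair.
(* After the points of enum J have been treated, every interval is a point. *)
suff [T' [T'T _ pairT' sgT']] : exists T' : J -> set R,
    [/\ forall j, T' j `<=` T j, forall j, is_interval (T' j),
        forall i j, T' i `&` thicken_line (T' j) (d i j) !=set0 &
        forall j, j \in enum J -> exists c, T' j `<=` [set c]].
  have /choice[g gP] j : exists c, T' j = [set c].
    have [|c cP] := sgT' j; first by rewrite mem_enum.
    exists c; apply/seteqP; split => // _ ->.
    by have [t [T't _]] := pairT' j j; rewrite -(cP _ T't).
  exists g; split=> [j|i j]; first by apply: T'T; rewrite gP.
  by have [t []] := pairT' i j; rewrite !gP => -> [s ->].
elim: (enum J) => [|j0 s [T' [T'T intT' pairT' sgT']]];
  first by exists T; split=> // j ?.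
have [c cP] : exists c, forall k, thicken_line (T' k) (d j0 k) c.
  apply: Helly_line => [k|k l]; first exact: is_interval_thicken_line.
  have [a [T'a [b T'b ab]]] := pairT' k l.
  have [|c [ca cb]] := @line_ball_intersect _ a b _ _ (d0 j0 k) (d0 j0 l).
    by rewrite (le_trans ab) // [d j0 k]dsym dtri.
  by exists c; split; [exists a|exists b].
exists (fun k => if k == j0 then [set c] else T' k); split.
- move=> k; case: eqP => [-> _ ->|_]; last exact: T'T.
  have [t T't] := cP j0; rewrite drefl lee_fin normr_le0 subr_eq0 => /eqP ->.
  exact: T'T.
- move=> k; case: eqP => // _ a b -> -> z; rewrite -eq_le => /eqP <- //.
- move=> k l; case: eqP => [->|_]; case: eqP => [->|_].
  + by exists c; split => //; exists c; rewrite // subrr normr0.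
  + by exists c; split.
  + have [a Ta ac] := cP k; exists a; split => //; exists c => //.
    by rewrite distrC dsym.
  + exact: pairT'.
- move=> k; rewrite inE; case: eqP => [_ _|_ /= ks]; first by exists c.
  exact: sgT'.
Qed.

(** * Convex sets in the plane and their neighbourhoods *)

Lemma convex_set2 (R : realType) (S : set (plane R)) (p q : plane R) (t : R) :
  convex_set S -> S p -> S q -> 0 <= t -> t <= 1 ->
  S (t * p.1 + (1 - t) * q.1, t * p.2 + (1 - t) * q.2).
Proof.
move=> cS Sp Sq t0 t1.
exact: (set_mem (cS p q (Itv01 t0 t1) (mem_set Sp) (mem_set Sq))).
Qed.

(** The converse of [convex_set2]. *)
Lemma convex_set_of_coord (R : realType) (S : set (plane R)) :
  (forall (p q : plane R) (t : R), S p -> S q -> 0 <= t -> t <= 1 ->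
     S (t * p.1 + (1 - t) * q.1, t * p.2 + (1 - t) * q.2)) ->
  convex_set S.
Proof.
move=> H p q l /set_mem Sp /set_mem Sq; apply/mem_set.
exact: (H p q l%:num).
Qed.

(** Unnormalized weights spare the users a division by their sum. *)
Lemma convex_set3 (R : realType) (S : set (plane R)) (p q r v : plane R)
    (a b c : R) :
  convex_set S -> S p -> S q -> S r -> 0 <= a -> 0 <= b -> 0 <= c ->
  0 < a + b + c ->
  (a + b + c) * v.1 = a * p.1 + b * q.1 + c * r.1 ->
  (a + b + c) * v.2 = a * p.2 + b * q.2 + c * r.2 -> S v.
Proof.
move=> cS Sp Sq Sr a0 b0 c0 abc0 v1 v2.
have [ab0|ab0] := ltP 0 (a + b).
  have Sw : S (a / (a + b) * p.1 + (1 - a / (a + b)) * q.1,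
               a / (a + b) * p.2 + (1 - a / (a + b)) * q.2).
    apply: convex_set2 => //; first by rewrite divr_ge0 // ltW.
    by rewrite ler_pdivrMr // mul1r lerDl.
  have -> : v = ((a + b) / (a + b + c) *
        (a / (a + b) * p.1 + (1 - a / (a + b)) * q.1) +
        (1 - (a + b) / (a + b + c)) * r.1,
      (a + b) / (a + b + c) *
        (a / (a + b) * p.2 + (1 - a / (a + b)) * q.2) +
        (1 - (a + b) / (a + b + c)) * r.2).
    have nab := lt0r_neq0 ab0; have nabc := lt0r_neq0 abc0.
    apply/eqP; rewrite [v]surjective_pairing -pair_eqE /=; apply/andP; split;
      apply/eqP/(mulfI nabc); rewrite ?v1 ?v2; field; by rewrite nab nabc.
  apply: (@convex_set2 _ _ (_, _) r) => //; first by rewrite divr_ge0 // ltW.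
  by rewrite ler_pdivrMr // mul1r lerDl.
have [a00 b00] : a = 0 /\ b = 0 by split; lra.
suff -> : v = r by [].
move: v1 v2 abc0; rewrite a00 b00 !mul0r !add0r => v1 v2 /lt0r_neq0 c00.
by rewrite [v]surjective_pairing [r]surjective_pairing (mulfI c00 v1)
  (mulfI c00 v2).
Qed.

Lemma convex_setI (R : realType) (A B : set (plane R)) :
  convex_set A -> convex_set B -> convex_set (A `&` B).
Proof.
move=> cA cB; apply: convex_set_of_coord => p q t [Ap Bp] [Aq Bq] t0 t1.
by split; apply: convex_set2.
Qed.

Lemma is_interval_proj (R : realType) (pr : plane R -> R) (S : set (plane R)) :
  (forall (t : R) (p q : plane R),
     pr (t * p.1 + (1 - t) * q.1, t * p.2 + (1 - t) * q.2) =
     t * pr p + (1 - t) * pr q) ->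
  convex_set S -> is_interval (pr @` S).
Proof.
move=> pr_affine cS _ _ [p Sp <-] [q Sq <-] z /andP[pz zq].
have [pq|npq] := eqVneq (pr p) (pr q).
  by exists p => //; apply/eqP; rewrite eq_le pz pq zq.
have d0 : 0 < pr q - pr p.
  by rewrite subr_gt0 lt_neqAle npq (le_trans pz zq).
exists (((pr q - z) / (pr q - pr p)) * p.1 +
    (1 - (pr q - z) / (pr q - pr p)) * q.1,
  ((pr q - z) / (pr q - pr p)) * p.2 +
    (1 - (pr q - z) / (pr q - pr p)) * q.2); last first.
  by rewrite pr_affine; field; exact: lt0r_neq0.
apply: convex_set2 => //; first by rewrite divr_ge0 ?subr_ge0 ?(le_trans pz zq).
by rewrite ler_pdivrMr // mul1r lerD2l lerN2.
Qed.

Lemma is_interval_section1 (R : realType) (S : set (plane R)) (x : R) :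
  convex_set S -> is_interval [set y | S (x, y)].
Proof.
move=> cS y1 y2 /= S1 S2 z zy; have [||||[a b] [Sab ax] /= bz] :=
    @is_interval_proj _ snd (S `&` [set p | p.1 = x]) _ _ y1 y2 _ _ z zy.
- by [].
- apply: convex_setI => //; apply: convex_set_of_coord => p q t /= -> -> _ _; ring.
- by exists (x, y1).
- by exists (x, y2).
- by rewrite -ax -bz.
Qed.

Lemma is_interval_section2 (R : realType) (S : set (plane R)) (y : R) :
  convex_set S -> is_interval [set x | S (x, y)].
Proof.
move=> cS x1 x2 /= S1 S2 z zx; have [||||[a b] [Sab /= bx] /= az] :=
    @is_interval_proj _ fst (S `&` [set p | p.2 = y]) _ _ x1 x2 _ _ z zx.
- by [].
- apply: convex_setI => //; apply: convex_set_of_coord => p q t /= -> -> _ _; ring.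
- by exists (x1, y).
- by exists (x2, y).
- by rewrite -bx -az.
Qed.

(** K + t Q0 for t in [0, +oo], in a form that treats t = +oo uniformly; see
    [minkowski_sum_scaleQ0]. *)
Definition thicken (R : realType) (K : set (plane R)) (t : \bar R) :
    set (plane R) :=
  [set v | exists2 s, K s & (`|v - s|%:E <= t)%E].

Lemma plane_dist_leP (R : realType) (v s : plane R) (t : \bar R) :
  (`|v - s|%:E <= t)%E <->
  (`|v.1 - s.1 : R|%:E <= t)%E /\ (`|v.2 - s.2 : R|%:E <= t)%E.
Proof.
rewrite norm_planeE /=; case: t => [r| |]; last 2 first.
- by rewrite !leey.
- by rewrite !leNgt !ltNyr; split => // -[].
by rewrite !lee_fin ge_max; split => [/andP[]//|[-> ->]].
Qed.

Lemma minkowski_sum_scaleQ0 (R : realType) (K : set (plane R)) (t : \bar R) :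
  (0 <= t)%E -> minkowski_sum K (scaleQ0 t) = thicken K t.
Proof.
case: t => [r| |//] t0; last first.
  apply/seteqP; split => v [s Ks].
    by move=> _; exists s => //; rewrite leey.
  by move=> _; exists s => //; exists (v - s) => //; rewrite addrC subrK.
rewrite lee_fin in t0; apply/seteqP; split => v [s Ks].
  move=> [_ [q [/= q1 q2] <-] <-]; exists s => //.
  rewrite addrAC subrr add0r lee_fin normrZ (ger0_norm t0) norm_planeE.
  rewrite ler_piMr // ge_max !ler_norml.
  by move: q1 q2; rewrite !in_itv /= => -> ->.
rewrite lee_fin norm_planeE ge_max => /andP[v1 v2].
exists s => //; exists (v - s); last by rewrite addrC subrK.
have [r0|r0] := eqVneq r 0.
  exists 0; first by split; rewrite /= in_itv /= lerN10 ler01.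
  rewrite r0 scale0r; apply/esym/eqP; rewrite -normr_le0 norm_planeE ge_max.
  by rewrite -r0 v1 v2.
have rp : 0 < r by rewrite lt_neqAle eq_sym r0.
exists (r^-1 *: (v - s)); last by rewrite scalerA divff // scale1r.
have scaled x : `|x| <= r -> `|r^-1 * x| <= 1.
  by rewrite normrM normfV (gtr0_norm rp) mulrC ler_pdivrMr // mul1r.
by split; rewrite /= in_itv /= -ler_norml; exact: scaled.
Qed.

Lemma thicken0 (R : realType) (K : set (plane R)) : thicken K 0%E = K.
Proof.
apply/seteqP; split => [v [s Ks]|v Kv]; last first.
  by exists v; rewrite // subrr normr0.
by rewrite lee_fin normr_le0 subr_eq0 => /eqP ->.
Qed.

Lemma subset_thicken (R : realType) (K : set (plane R)) (t t' : \bar R) :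
  (t <= t')%E -> thicken K t `<=` thicken K t'.
Proof. by move=> tt' v [s Ks vs]; exists s => //; exact: le_trans tt'. Qed.

Lemma thicken_segment (R : realType) (K : set (plane R)) (a v : plane R)
    (al be t : R) :
  convex_set K -> thicken K al%:E a -> thicken K be%:E v ->
  0 <= t -> t <= 1 ->
  thicken K (t * be + (1 - t) * al)%:E (t *: v + (1 - t) *: a).
Proof.
move=> cK [s Ks sa] [u Ku uv] t0 t1; rewrite !lee_fin in sa uv.
exists (t *: u + (1 - t) *: s); first exact: convex_set2 cK Ku Ks t0 t1.
have t1' : 0 <= 1 - t by rewrite subr_ge0.
rewrite lee_fin opprD addrACA -!scalerBr.
apply: le_trans (ler_normD _ _) _; rewrite !normrZ (ger0_norm t0) (ger0_norm t1').
by apply: lerD; apply: ler_wpM2l.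
Qed.

Lemma convex_thicken (R : realType) (K : set (plane R)) (t : \bar R) :
  convex_set K -> convex_set (thicken K t).
Proof.
move=> cK; apply: convex_set_of_coord => v w l [s Ks sv] [u Ku uw] l0 l1.
eexists; first exact: convex_set2 cK Ks Ku l0 l1.
move: sv uw => /plane_dist_leP[s1 s2] /plane_dist_leP[w1 w2].
have convex_dist (a b c e : R) :
    (`|a - c|%:E <= t -> `|b - e|%:E <= t ->
     `|(l * a + (1 - l) * b) - (l * c + (1 - l) * e)|%:E <= t)%E.
  case: t {s1 s2 w1 w2} => [r| |]; [|by rewrite !leey|]; last first.
    by move=> /(lt_le_trans (ltNyr _)); rewrite ltxx.
  rewrite !lee_fin => ac be.
  have -> : l * a + (1 - l) * b - (l * c + (1 - l) * e) =
    l * (a - c) + (1 - l) * (b - e) by ring.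
  apply: le_trans (ler_normD _ _) _; rewrite !normrM (ger0_norm l0).
  have l1' : 0 <= 1 - l by rewrite subr_ge0.
  rewrite (ger0_norm l1').
  have -> : r = l * r + (1 - l) * r by ring.
  by apply: lerD; apply: ler_wpM2l.
by apply/plane_dist_leP; split; apply: convex_dist.
Qed.

Lemma compact_plane_ball (R : realType) (v : plane R) (r : R) :
  compact [set s : plane R | `|v - s| <= r].
Proof.
have -> : [set s : plane R | `|v - s| <= r] =
    ([set` `[v.1 - r, v.1 + r]] : set R^o) `*`
    ([set` `[v.2 - r, v.2 + r]] : set R^o).
  apply/seteqP; split => [s|s] /=; rewrite norm_planeE ge_max !ler_norml /=.
    move=> /andP[/andP[? ?] /andP[? ?]]; rewrite !in_itv /=.
    by split; apply/andP; lra.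
  rewrite !in_itv /= => -[/andP[? ?] /andP[? ?]].
  by apply/andP; split; apply/andP; lra.
by apply: compact_setX; exact: segment_compact.
Qed.

Lemma closed_nearest (R : realType) (K : set (plane R)) (v : plane R) :
  closed K -> K !=set0 ->
  exists2 s, K s & forall s', K s' -> `|v - s| <= `|v - s'|.
Proof.
move=> clK [s0 Ks0].
pose B := [set s : plane R | `|v - s| <= `|v - s0|] `&` K.
have cB : compact B by apply: compact_closedI => //; exact: compact_plane_ball.
have cf : {within B, continuous (fun s : plane R => `|v - s|)}.
  apply: continuous_subspaceT => s.
  apply: cvg_norm; apply: cvgB; [exact: cvg_cst|exact: cvg_id].
have [|s /set_mem[_ Ks] smin] := compact_EVT_min _ cB cf.
  by exists s0; split => //=.
exists s => // s' Ks'; have [ss'|/ltW s's] := leP `|v - s'| `|v - s0|.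
  by apply: smin; apply/mem_set.
by apply: le_trans s's; apply: smin; apply/mem_set; split => /=.
Qed.

Lemma thicken_limit (R : realType) (K : set (plane R)) (r : R) (v : plane R) :
  closed K -> K !=set0 ->
  (forall eps, 0 < eps -> thicken K (r + eps)%:E v) -> thicken K r%:E v.
Proof.
move=> clK K0 near; have [s Ks smin] := closed_nearest v clK K0.
exists s => //; rewrite lee_fin; apply/ler_addgt0Pr => e e0.
by have [s' Ks'] := near _ e0; rewrite lee_fin; apply: le_trans; exact: smin.
Qed.

Lemma closed_thicken (R : realType) (K : set (plane R)) (t : \bar R) :
  closed K -> K !=set0 -> closed (thicken K t).
Proof.
move=> clK [s0 Ks0]; case: t => [r| |].
- move=> v vK; apply: thicken_limit => //; first by exists s0.
  move=> e e0; have [w [[s Ks ws] vw]] := vK _ (nbhsx_ballx v e e0).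
  exists s => //; rewrite -ball_normE /= in vw; rewrite lee_fin in ws *.
  rewrite -[v - s](subrKA w) addrC; apply: le_trans (ler_normD _ _) _.
  by rewrite lerD // ltW.
- suff -> : thicken K +oo = setT by exact: closedT.
  by apply/seteqP; split => // v _; exists s0; rewrite // leey.
- suff -> : thicken K -oo = set0 by exact: closed0.
  by apply/seteqP; split => // v [s _]; rewrite leNgt ltNyr.
Qed.

(** * Corners: the nearest point to a point of the rectangular hull *)

(** The shape of the nearest point p to a in the intersection of the A j, for a
    in its rectangular hull.  If p <> a, then p is a corner of a square centred
    at a; the signs e1, e2 tell which corner.  The points (a.1, u2) and
    (w1, a.2) are the witnesses that a is in the rectangular hull, and the last
    clause says that one of the sets A j misses the open quadrant with vertex p
    that contains a. *)
Definition is_corner (R : realType) (J : Type) (A : J -> set (plane R))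
    (a p : plane R) : Prop :=
  p = a \/ exists e1 e2 r u2 w1 : R,
    [/\ (e1 = 1 \/ e1 = -1) /\ (e2 = 1 \/ e2 = -1),
        0 < r /\ p = (a.1 + r * e1, a.2 + r * e2),
        (forall j, A j (a.1, u2)) /\ 0 <= e2 * (u2 - p.2),
        (forall j, A j (w1, a.2)) /\ 0 <= e1 * (w1 - p.1) &
        exists j, forall v, A j v ->
          0 <= e1 * (v.1 - p.1) \/ 0 <= e2 * (v.2 - p.2)].

Lemma sign_of_neq (R : realType) (x y : R) : x != y ->
  exists e : R, (e = 1 \/ e = -1) /\ 0 < e * (x - y).
Proof.
rewrite neq_lt => /orP[xy|yx]; [exists (-1)|exists 1]; split; auto.
  by rewrite mulN1r opprB subr_gt0.
by rewrite mul1r subr_gt0.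
Qed.

(** In coordinates centred at p and reflected by e1, e2, the points u, w, d
    are (-r, >= 0), (>= 0, -r) and (< 0, < 0).  The direction (-1, -1) then
    lies in the cone spanned by d and w if d is above the diagonal, and in the
    cone spanned by d and u otherwise. *)
Lemma convex_diagonal_step (R : realType) (S : set (plane R))
    (p u w d : plane R) (e1 e2 r : R) :
  convex_set S -> (e1 = 1 \/ e1 = -1) -> (e2 = 1 \/ e2 = -1) -> 0 < r ->
  S p -> S u -> S w -> S d ->
  e1 * (u.1 - p.1) = - r -> 0 <= e2 * (u.2 - p.2) ->
  0 <= e1 * (w.1 - p.1) -> e2 * (w.2 - p.2) = - r ->
  e1 * (d.1 - p.1) < 0 -> e2 * (d.2 - p.2) < 0 ->
  exists2 eps, 0 < eps & S (p.1 - eps * e1, p.2 - eps * e2).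
Proof.
move=> cS e1P e2P r0 Sp Su Sw Sd u1 u2 w1 w2 d1 d2.
set al := e2 * (u.2 - p.2) in u2; set be := e1 * (w.1 - p.1) in w1.
set x := - (e1 * (d.1 - p.1)); set y := - (e2 * (d.2 - p.2)).
have x0 : 0 < x by rewrite oppr_gt0.
have y0 : 0 < y by rewrite oppr_gt0.
have e1V z : z = e1 * (e1 * z) by case: e1P => ->; ring.
have e2V z : z = e2 * (e2 * z) by case: e2P => ->; ring.
have [u1E u2E] : u.1 = p.1 - e1 * r /\ u.2 = p.2 + e2 * al.
  by rewrite -[r]opprK -u1 mulrN -e1V -e2V; split; ring.
have [w1E w2E] : w.1 = p.1 + e1 * be /\ w.2 = p.2 - e2 * r.
  by rewrite -[r]opprK -w2 mulrN -e1V -e2V; split; ring.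
have [d1E d2E] : d.1 = p.1 - e1 * x /\ d.2 = p.2 - e2 * y.
  by rewrite /x /y !mulrN -e1V -e2V; split; ring.
clearbody al be x y.
have [yx|/ltW xy] := leP y x.
  (* In the coordinates centred at p,
     -(1, 1) = (r + be) / D * d + (x - y) / D * w. *)
  pose D := be * y + r * x.
  have D0 : 0 < D by rewrite ltr_wpDl ?mulr_gt0 ?mulr_ge0 // ltW.
  have xy0 : 0 <= x - y by rewrite subr_ge0.
  have Z0 : 0 < r + be + (x - y) + D by lra.
  exists (D / (r + be + (x - y) + D)).
    by rewrite divr_gt0.
  apply: (convex_set3 (p := d) (q := w) (r := p)
    (a := r + be) (b := x - y) (c := D)) => //=; try lra;
    rewrite ?d1E ?d2E ?w1E ?w2E /D; field; exact: lt0r_neq0 Z0.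
pose D := al * x + r * y.
have D0 : 0 < D by rewrite ltr_wpDl ?mulr_gt0 ?mulr_ge0 // ltW.
have xy0 : 0 <= y - x by rewrite subr_ge0.
have Z0 : 0 < r + al + (y - x) + D by lra.
exists (D / (r + al + (y - x) + D)).
  by rewrite divr_gt0.
apply: (convex_set3 (p := d) (q := u) (r := p)
  (a := r + al) (b := y - x) (c := D)) => //=; try lra;
  rewrite ?d1E ?d2E ?u1E ?u2E /D; field; exact: lt0r_neq0 Z0.
Qed.

(** Here p is the first point of the intersection on the diagonal ray from a
    towards the two given points.  If every A j met the open quadrant behind p,
    [convex_diagonal_step] would put a piece of the ray just before p into
    every A j, hence, J being finite, into the intersection. *)
Lemma exists_corner (R : realType) (J : finType) (A : J -> set (plane R))
    (a : plane R) (u2 w1 : R) :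
  (forall j, convex_set (A j)) -> (forall j, closed (A j)) ->
  (forall j, A j (a.1, u2)) -> (forall j, A j (w1, a.2)) ->
  exists p, (forall j, A j p) /\ is_corner A a p.
Proof.
move=> cA clA Au Aw.
have [Aa|nAa] := pselect (forall j, A j a); first by exists a; split; auto; left.
have /sign_of_neq[e2 [e2P U0]] : u2 != a.2.
  apply: contra_not_neq nAa => u2a j.
  by rewrite [a]surjective_pairing -u2a.
have /sign_of_neq[e1 [e1P W0]] : w1 != a.1.
  apply: contra_not_neq nAa => w1a j.
  by rewrite [a]surjective_pairing -w1a.
have e1V z : z = e1 * (e1 * z) by case: e1P => ->; ring.
have e2V z : z = e2 * (e2 * z) by case: e2P => ->; ring.
set U := e2 * (u2 - a.2) in U0; set W := e1 * (w1 - a.1) in W0.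
have u2E : u2 = a.2 + e2 * U by rewrite /U -e2V; ring.
have w1E : w1 = a.1 + e1 * W by rewrite /W -e1V; ring.
pose h (t : R^o) : plane R := (a.1 + t * e1, a.2 + t * e2).
have hc : continuous h.
  move=> t; apply: (@cvg_pair _ _ _ _ (nbhs (a.1 + t * e1 : R^o))
    (nbhs (a.2 + t * e2 : R^o))).
  - by apply: cvgD; [exact: cvg_cst|apply: cvgMl; exact: cvg_id].
  - by apply: cvgD; [exact: cvg_cst|apply: cvgMl; exact: cvg_id].
(* The segment between the two given points crosses the ray at parameter t0. *)
pose t0 := U * W / (U + W).
have UW0 : 0 < U + W by rewrite addr_gt0.
have t00 : 0 <= t0 by apply: divr_ge0; [apply: mulr_ge0|]; apply: ltW.
pose E := `[0, t0]%classic `&` [set t : R^o | forall j, A j (h t)].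
have cE : compact (E : set R^o).
  apply: compact_closedI; first exact: segment_compact.
  have -> : [set t : R^o | forall j, A j (h t)] =
      \bigcap_(j in [set: J]) (h @^-1` A j).
    by apply/seteqP; split=> t /= H j; [move=> _|]; exact: H.
  by apply: closed_bigI => j _; apply: preimage_closed.
have Et0 : E t0.
  split=> [|j]; first by rewrite /= in_itv /= t00 lexx.
  apply: (convex_set3 (p := (a.1, u2)) (q := (w1, a.2)) (r := (w1, a.2))
    (a := W) (b := U) (c := 0) (cA j) (Au j) (Aw j) (Aw j)) => //=;
    try (by apply: ltW); rewrite ?addr0 1?addrC //.
  - by rewrite w1E /t0; field; exact: lt0r_neq0.
  - by rewrite u2E /t0; field; exact: lt0r_neq0.
have cid : {within (E : set R^o), continuous (fun t : R^o => t : R)}.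
  by apply: continuous_subspaceT => x; exact: cvg_id.
have [r /set_mem[]] := compact_EVT_min (ex_intro _ _ Et0) cE cid.
rewrite /= in_itv /= => /andP[r0 rt0] Ar rmin.
have {}rmin t : 0 <= t -> t < r -> ~ forall j, A j (h t).
  move=> tt0 tr At; have := rmin t; rewrite leNgt tr => H.
  suff : false by []; apply: H; apply/mem_set; split => //=.
  by rewrite in_itv /= tt0 (le_trans (ltW tr)).
have r_gt0 : 0 < r.
  rewrite lt_neqAle r0 andbT; apply: contra_not_neq nAa => r00 j.
  have := Ar j; rewrite /h -r00 !mul0r !addr0; by case: (a).
have rUW : r <= U /\ r <= W.
  split; apply: (le_trans rt0); rewrite /t0 ler_pdivrMr //.
    by rewrite ler_pM2l // lerDr ltW.
  by rewrite mulrC ler_pM2l // lerDl ltW.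
exists (h r); split; first exact: Ar.
right; exists e1, e2, r, u2, w1; split => //=.
- by split => //; rewrite u2E; case: e2P => ->; lra.
- by split => //; rewrite w1E; case: e1P => ->; lra.
apply: contrapT => /forallNP noj.
have /choice[eps epsP] j : exists eps, 0 < eps /\ A j (h (r - eps)).
  have /existsNP[d /not_implyP[Ad /not_orP[/negP d1 /negP d2]]] := noj j.
  rewrite -!ltNge in d1 d2.
  have [||||||eps eps0 Aeps] := @convex_diagonal_step _ (A j) (h r)
      (a.1, u2) (w1, a.2) d e1 e2 r (cA j) e1P e2P r_gt0 (Ar j) (Au j) (Aw j) Ad.
  - by rewrite /=; case: e1P => ->; ring.
  - by rewrite /= u2E; case: e2P => ->; lra.
  - by rewrite /= w1E; case: e1P => ->; lra.
  - by rewrite /=; case: e2P => ->; ring.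
  - exact: d1.
  - exact: d2.
  exists eps; split => //.
  move: Aeps; rewrite /h /=; congr (A j (_, _)); ring.
have [j0 _|J0] := pickP J; last first.
  by apply: (rmin 0) => // j; have := J0 j.
pose j1 := [arg min_(j < j0) eps j]%O.
have j1P j : eps j1 <= eps j by rewrite /j1; case: arg_minP => // k _; exact.
(* A step of length m backwards from p stays on the ray and in every A j. *)
pose m := Num.min r (eps j1).
have m0 : 0 < m by rewrite lt_min r_gt0 (proj1 (epsP _)).
apply: (rmin (r - m)); [by rewrite subr_ge0 ge_min lexx|by rewrite gtrBl|].
move=> j; have [ej0 Aj] := epsP j.
have me : m <= eps j by rewrite ge_min j1P orbT.
apply: (convex_set3 (p := h r) (q := h (r - eps j)) (r := h r)
  (a := eps j - m) (b := m) (c := 0)) => //=; try lra; try ring.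
Qed.

(** * The distance between two corners *)

Definition box_near (R : realType) (A B : set (plane R)) (d : R) : Prop :=
  forall v, A v ->
    exists2 v', B v' & `|v.1 - v'.1 : R| <= d /\ `|v.2 - v'.2 : R| <= d.

Lemma box_near_thicken (R : realType) (K : set (plane R)) (t t' : \bar R)
    (r : R) :
  (0 <= t')%E -> 0 <= r -> (t <= r%:E + t')%E ->
  box_near (thicken K t) (thicken K t') r.
Proof.
move=> t'0 r0 tt' v [s Ks /plane_dist_leP[v1 v2]].
have r0' : (0 <= r%:E)%E by rewrite lee_fin.
have [c1 [vc1 cs1]] := line_ball_intersect r0' t'0 (le_trans v1 tt').
have [c2 [vc2 cs2]] := line_ball_intersect r0' t'0 (le_trans v2 tt').
exists (c1, c2); first by exists s => //; apply/plane_dist_leP.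
by rewrite /= (distrC v.1) (distrC v.2) -!lee_fin.
Qed.

Lemma avoid_quadrant_near (R : realType) (A B : set (plane R)) (p : plane R)
    (e1 e2 d : R) :
  (e1 = 1 \/ e1 = -1) -> (e2 = 1 \/ e2 = -1) -> box_near B A d ->
  (forall v, A v -> 0 <= e1 * (v.1 - p.1) \/ 0 <= e2 * (v.2 - p.2)) ->
  forall v, B v -> - d <= e1 * (v.1 - p.1) \/ - d <= e2 * (v.2 - p.2).
Proof.
move=> e1P e2P BA Aq v /BA[v' /Aq + []]; rewrite !ler_norml.
move=> [] v'p /andP[? ?] /andP[? ?]; [left|right].
  by case: e1P v'p => ->; lra.
by case: e2P v'p => ->; lra.
Qed.

(** The arithmetic of [corner_dist], after a reflection that turns p - a into
    r (1, 1).  Each disjunction says that one of six points enters the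
    quadrant cut off by the other corner by at most d: q, x = (b1, x2) and
    y = (y1, b2) for the quadrant at p, and p, u = (a1, u2) and w = (w1, a2)
    for the one at q.  When the two corners point the same way, or opposite
    ways in both coordinates, p and q suffice; when they are opposite in
    exactly one coordinate, bounding r + s takes the other points as well. *)
Lemma corner_arith (R : realType)
    (a1 a2 b1 b2 p1 p2 q1 q2 d r s u2 w1 x2 y1 g1 g2 : R) :
  (g1 = 1 \/ g1 = -1) -> (g2 = 1 \/ g2 = -1) -> 0 < r -> 0 < s ->
  `|a1 - b1| <= d -> `|a2 - b2| <= d ->
  p1 = a1 + r -> p2 = a2 + r -> q1 = b1 + s * g1 -> q2 = b2 + s * g2 ->
  0 <= w1 - p1 -> 0 <= u2 - p2 -> 0 <= g1 * (y1 - q1) -> 0 <= g2 * (x2 - q2) ->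
  (- d <= q1 - p1 \/ - d <= q2 - p2) ->
  (- d <= b1 - p1 \/ - d <= x2 - p2) ->
  (- d <= y1 - p1 \/ - d <= b2 - p2) ->
  (- d <= g1 * (p1 - q1) \/ - d <= g2 * (p2 - q2)) ->
  (- d <= g1 * (a1 - q1) \/ - d <= g2 * (u2 - q2)) ->
  (- d <= g1 * (w1 - q1) \/ - d <= g2 * (a2 - q2)) ->
  `|p1 - q1| <= 3 * d /\ `|p2 - q2| <= 3 * d.
Proof.
move=> g1P g2P r0 s0; rewrite !ler_norml.
move=> /andP[ab1 ab1'] /andP[ab2 ab2'] -> -> -> ->.
move: g1P g2P => [] -> [] -> w u y x qN xN yN pN uN wN.
- by clear xN yN uN wN; case: qN => ?; case: pN => ?; split; apply/andP; lra.
- clear yN wN.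
  case: qN => ?; last by clear xN pN uN; split; apply/andP; lra.
  case: pN => ?; last by clear xN uN; split; apply/andP; lra.
  case: xN => ?; last by clear uN; split; apply/andP; lra.
  by case: uN => ?; split; apply/andP; lra.
- clear xN uN.
  case: qN => ?; first by clear yN pN wN; split; apply/andP; lra.
  case: pN => ?; first by clear yN wN; split; apply/andP; lra.
  case: yN => ?; first by clear wN; split; apply/andP; lra.
  by case: wN => ?; split; apply/andP; lra.
- by clear xN yN uN wN pN; case: qN => ?; split; apply/andP; lra.
Qed.

(** The quadrant cut off by p is missed by a single A j, so B j, being close
    to A j, enters it by at most d, and likewise with the roles exchanged. *)
Lemma corner_dist (R : realType) (J : Type) (A B : J -> set (plane R))
    (a b p q : plane R) (d : R) :
  (forall j, box_near (A j) (B j) d) -> (forall j, box_near (B j) (A j) d) ->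
  (forall j, A j p) -> (forall j, B j q) ->
  is_corner A a p -> is_corner B b q ->
  `|a.1 - b.1 : R| <= d -> `|a.2 - b.2 : R| <= d ->
  `|p.1 - q.1 : R| <= 3 * d /\ `|p.2 - q.2 : R| <= 3 * d.
Proof.
(* The case in which only one of the two points is a proper corner. *)
have one_corner (e1 e2 r x1 x2 y1 y2 p1 p2 : R) :
    e1 = 1 \/ e1 = -1 -> e2 = 1 \/ e2 = -1 -> 0 < r ->
    p1 = y1 + r * e1 -> p2 = y2 + r * e2 ->
    - d <= e1 * (x1 - p1) \/ - d <= e2 * (x2 - p2) ->
    `|x1 - y1| <= d -> `|x2 - y2| <= d ->
    `|x1 - p1| <= 3 * d /\ `|x2 - p2| <= 3 * d.
  move=> e1P e2P r0 -> ->; rewrite !ler_norml.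
  move=> near /andP[? ?] /andP[? ?]; case: e1P near => ->; case: e2P => ->;
    case=> ?; split; apply/andP; lra.
move=> AB BA Ap Bq cA cB ab1 ab2.
case: cA => [pa|[e1 [e2 [r [u2 [w1 [[e1P e2P] [r0 pE] [Au u2P] [Aw w1P]
  [j Aj]]]]]]]]; case: cB => [qb|[f1 [f2 [s [x2 [y1 [[f1P f2P] [s0 qE]
    [Bx x2P] [By y1P] [k Bk]]]]]]]].
- have d0 : 0 <= d := le_trans (normr_ge0 _) ab1.
  have d3 : d <= 3 * d by clear - d0; lra.
  by rewrite pa qb !(le_trans _ d3).
- have pN := avoid_quadrant_near f1P f2P (AB k) Bk (Ap k).
  rewrite pa in pN *.
  by apply: (one_corner f1 f2 s) pN ab1 ab2; rewrite ?qE.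
- have qN := avoid_quadrant_near e1P e2P (BA j) Aj (Bq j).
  rewrite qb in qN *; rewrite (distrC p.1) (distrC p.2).
  rewrite distrC in ab1; rewrite distrC in ab2.
  by apply: (one_corner e1 e2 r) qN ab1 ab2; rewrite ?pE.
have Hq v := @avoid_quadrant_near _ _ _ p e1 e2 d e1P e2P (BA j) Aj v.
have Hp v := @avoid_quadrant_near _ _ _ q f1 f2 d f1P f2P (AB k) Bk v.
have e11 z : e1 * (e1 * z) = z by case: e1P => ->; ring.
have e22 z : e2 * (e2 * z) = z by case: e2P => ->; ring.
have e2e : e2 * e2 = 1 by case: e2P => ->; ring.
have e1e : e1 * e1 = 1 by case: e1P => ->; ring.
(* Reflection by e1 and e2 is an isometry that turns p - a into r (1, 1). *)
have norm1 x y : `|x - y| = `|e1 * x - e1 * y|.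
  by rewrite -mulrBr normrM; case: e1P => ->; rewrite ?normrN normr1 mul1r.
have norm2 x y : `|x - y| = `|e2 * x - e2 * y|.
  by rewrite -mulrBr normrM; case: e2P => ->; rewrite ?normrN normr1 mul1r.
have e1B x y : e1 * (x - y) = e1 * x - e1 * y by rewrite mulrBr.
have e2B x y : e2 * (x - y) = e2 * x - e2 * y by rewrite mulrBr.
have f1E x y : f1 * (x - y) = e1 * f1 * (e1 * x - e1 * y).
  by rewrite -e1B -{1}[f1 * _]e11; ring.
have f2E x y : f2 * (x - y) = e2 * f2 * (e2 * x - e2 * y).
  by rewrite -e2B -{1}[f2 * _]e22; ring.
have gP e f : (e = 1 \/ e = -1) -> (f = 1 \/ f = -1) ->
    e * f = 1 \/ e * f = -1 :> R.
  by move=> [->|->] [->|->]; rewrite ?mulN1r ?mul1r ?opprK; auto.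
have := Hq _ (Bq j); have := Hp _ (Ap k).
have := Hq _ (Bx j); have := Hq _ (By j).
have := Hp _ (Au k); have := Hp _ (Aw k).
rewrite /= (norm1 p.1) (norm2 p.2) !f1E !f2E !e1B !e2B => wN uN yN xN pN qN.
rewrite (norm1 a.1) in ab1; rewrite (norm2 a.2) in ab2.
rewrite e1B in w1P; rewrite e2B in u2P.
rewrite f1E in y1P; rewrite f2E in x2P.
apply: (@corner_arith R (e1 * a.1) (e2 * a.2) (e1 * b.1) (e2 * b.2)
  (e1 * p.1) (e2 * p.2) (e1 * q.1) (e2 * q.2) d r s (e2 * u2) (e1 * w1)
  (e2 * x2) (e1 * y1) (e1 * f1) (e2 * f2)) => //.
- exact: gP.
- exact: gP.
- by rewrite pE /= mulrDr mulrCA e1e mulr1.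
- by rewrite pE /= mulrDr mulrCA e2e mulr1.
- by rewrite qE /= mulrDr mulrCA.
- by rewrite qE /= mulrDr mulrCA.
Qed.

(** * Selections over a finite domain *)

Section FiniteSelection.
Variables (R : realType) (I : finType) (d : I -> I -> \bar R).
Variable F : I -> set (plane R).
Hypotheses (dP : is_pseudometric d) (FP : forall x, Conv (F x)).

(** For d = lambda * rho, its rectangular hull is W at x, x', x''. *)
Let slab (x x' x'' : I) : set (plane R) :=
  thicken (F x') (d x' x) `&` thicken (F x'') (d x'' x).

(** The line theorem is applied to the triples (x, x', x''), at mutual
    distances d between their first components.  Triples with the same first
    component are at distance 0, so the selection does not see x' and x''. *)
Lemma proj_selection (pr : plane R -> R) :
  (forall (t : R) (p q : plane R),
     pr (t * p.1 + (1 - t) * q.1, t * p.2 + (1 - t) * q.2) =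
     t * pr p + (1 - t) * pr q) ->
  (forall x x' x'' y y' y'',
     (pr @` slab x x' x'') `&` thicken_line (pr @` slab y y' y'') (d x y) !=set0) ->
  exists g : I -> R, (forall x x' x'', (pr @` slab x x' x'') (g x)) /\
    forall x y, (`|g x - g y|%:E <= d x y)%E.
Proof.
move=> pr_affine near; have [d0 drefl dsym dtri] := dP.
have cF x : convex_set (F x) by have [] := FP x.
pose base (j : I * I * I) := j.1.1.
have [|||g [gS gd]] := @Lipschitz_selection_line R (I * I * I)%type
    (fun i j => d (base i) (base j)) (fun j => pr @` slab j.1.1 j.1.2 j.2).
- by split.
- move=> j; apply: is_interval_proj => //.
  by apply: convex_setI; exact: convex_thicken.
- by move=> i j; exact: near.
exists (fun x => g (x, x, x)); split => [x x' x''|x y]; last exact: gd.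
suff <- : g (x, x', x'') = g (x, x, x) by exact: (gS (x, x', x'')).
have := gd (x, x', x'') (x, x, x).
by rewrite /base /= drefl lee_fin normr_le0 subr_eq0 => /eqP.
Qed.

(** The point (g1 x, g2 x) lies in the rectangular hull of the intersection of
    the F z + d(z, x) Q0, and f x is the corner attached to it. *)
Lemma finite_selection :
  (forall x x' x'' y y' y'',
     (fst @` slab x x' x'') `&` thicken_line (fst @` slab y y' y'') (d x y)
       !=set0) ->
  (forall x x' x'' y y' y'',
     (snd @` slab x x' x'') `&` thicken_line (snd @` slab y y' y'') (d x y)
       !=set0) ->
  exists f : I -> plane R, is_selection F f /\
    forall x y, (`|f x - f y|%:E <= 3%:E * d x y)%E.
Proof.
move=> near1 near2; have [d0 drefl dsym dtri] := dP.
have cA x z : convex_set (thicken (F z) (d z x)).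
  by apply: convex_thicken; have [] := FP z.
have clA x z : closed (thicken (F z) (d z x)).
  by apply: closed_thicken; have [] := FP z.
have [//|g1 [g1S g1d]] := proj_selection _ near1.
have [//|g2 [g2S g2d]] := proj_selection _ near2.
have /choice[u2 u2P] x : exists u2, forall z, thicken (F z) (d z x) (g1 x, u2).
  apply: Helly_line => [z|z' z'']; first exact: is_interval_section1.
  by have [[v1 v2] /= [v' v''] <-] := g1S x z' z''; exists v2.
have /choice[w1 w1P] x : exists w1, forall z, thicken (F z) (d z x) (w1, g2 x).
  apply: Helly_line => [z|z' z'']; first exact: is_interval_section2.
  by have [[v1 v2] /= [v' v''] <-] := g2S x z' z''; exists v1.
have /choice[f fP] x := exists_corner (a := (g1 x, g2 x))
  (cA x) (clA x) (u2P x) (w1P x).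
exists f; split=> [x|x y].
  by have [/(_ x)] := fP x; rewrite drefl thicken0.
have [dxy|dxy] := eqVneq (d x y) +oo%E.
  by rewrite dxy gt0_muley ?lte_fin ?leey.
have dE : d x y = (fine (d x y))%:E.
  by rewrite fineK // ge0_fin_numE // lt_neqAle dxy leey.
set r := fine (d x y) in dE.
have r0 : 0 <= r by rewrite -lee_fin -dE.
rewrite dE -EFinM; apply/plane_dist_leP; rewrite !lee_fin.
have [Ax cx] := fP x; have [Ay cy] := fP y.
apply: corner_dist cx cy _ _ => //.
- move=> z; apply: box_near_thicken => //.
  by rewrite -dE addeC [d x y]dsym; exact: dtri.
- move=> z; apply: box_near_thicken => //.
  by rewrite -dE addeC; exact: dtri.
- by rewrite /= -lee_fin -dE.
- by rewrite /= -lee_fin -dE.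
Qed.

End FiniteSelection.

(** * The condition on the sets W *)

Lemma escale_ge0 (R : realType) (lam : R) (t : \bar R) :
  0 <= lam -> (0 <= t)%E -> (0 <= escale lam t)%E.
Proof.
by move=> lam0 t0; rewrite /escale; case: eqP => // _; rewrite mule_ge0.
Qed.

Lemma pseudometric_escale (R : realType) (M : Type) (rho : M -> M -> \bar R)
    (lam : R) :
  is_pseudometric rho -> 0 <= lam ->
  is_pseudometric (fun x y => escale lam (rho x y)).
Proof.
move=> [d0 drefl dsym dtri] lam0; split.
- by move=> x y; exact: escale_ge0.
- by move=> x; rewrite drefl /escale /= mule0.
- by move=> x y; rewrite dsym.
- move=> x y z; have := dtri x y z; have := d0 x y.
  have := d0 x z; have := d0 z y; rewrite /escale.
  case: (rho x z) => [a| |] //; case: (rho z y) => [b| |] //;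
    case: (rho x y) => [c| |] //= *; rewrite ?leey //.
  by rewrite -!EFinM -EFinD lee_fin -mulrDr ler_wpM2l // -lee_fin EFinD.
Qed.

Lemma escale3 (R : realType) (lam : R) (t : \bar R) :
  (escale (3 * lam) t = 3%:E * escale lam t)%E.
Proof.
rewrite /escale; case: eqP => [_|_]; last by rewrite EFinM muleA.
by rewrite gt0_muley // lte_fin.
Qed.

Lemma subset_rect_hull (R : realType) (S : set (plane R)) : S `<=` rect_hull S.
Proof. by move=> p Sp A [_]; exact. Qed.

Lemma W_proj (R : realType) (M : Type) (rho : M -> M -> \bar R)
    (F : M -> set (plane R)) (lam : R) (x x' x'' : M) (p : plane R) :
  is_pseudometric rho -> (forall x, Conv (F x)) -> 0 <= lam ->
  W rho F lam x x' x'' p ->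
  let S := thicken (F x') (escale lam (rho x' x)) `&`
           thicken (F x'') (escale lam (rho x'' x)) in
  (fst @` S) p.1 /\ (snd @` S) p.2.
Proof.
move=> dP FP lam0; have [d0 _ _ _] := dP.
rewrite /W !minkowski_sum_scaleQ0; try exact: escale_ge0.
rewrite rect_hullE; first by [].
by apply: convex_setI; apply: convex_thicken; have [] := FP x'; have [] := FP x''.
Qed.

(** The finite selection theorem on a finite family of points m of M: all that
    it needs is the pullback of rho and F along m. *)
Lemma W_condition_finite_selection (R : realType) (M : Type)
    (rho : M -> M -> \bar R) (F : M -> set (plane R)) (lam : R)
    (I : finType) (m : I -> M) :
  is_pseudometric rho -> (forall x, Conv (F x)) -> 0 <= lam ->
  W_condition rho F lam ->
  exists f : I -> plane R, (forall i, F (m i) (f i)) /\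
    forall i j, (`|f i - f j|%:E <= escale (3 * lam) (rho (m i) (m j)))%E.
Proof.
move=> dP FP lam0 Wc; have dlP := pseudometric_escale dP lam0.
have [d0 _ _ _] := dlP.
pose d i j := escale lam (rho (m i) (m j)).
have dmP : is_pseudometric d.
  by split=> [i j|i|i j|i j k]; move: dlP => [? ? ? ?]; rewrite /d; auto.
have near x x' x'' y y' y'' := Wc (m x) (m x') (m x'') (m y) (m y') (m y'').
have {}near x x' x'' y y' y'' : exists v v' : plane R,
    [/\ W rho F lam (m x) (m x') (m x'') v,
        W rho F lam (m y) (m y') (m y'') v' &
        (`|v.1 - v'.1 : R|%:E <= d x y)%E /\
        (`|v.2 - v'.2 : R|%:E <= d x y)%E].
  have [v [Wv]] := near x x' x'' y y' y''.
  rewrite minkowski_sum_scaleQ0; last exact: d0.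
  by move=> [v' Wv' /plane_dist_leP vv']; exists v, v'.
have [||f [Ff fd]] := @finite_selection R I d (F \o m) dmP (fun i => FP (m i)).
- move=> x x' x'' y y' y''; have [v [v' [Wv Wv' [vv' _]]]] := near x x' x'' y y' y''.
  exists v.1; split; first exact: (W_proj dP FP lam0 Wv).1.
  by exists v'.1; first exact: (W_proj dP FP lam0 Wv').1.
- move=> x x' x'' y y' y''; have [v [v' [Wv Wv' [_ vv']]]] := near x x' x'' y y' y''.
  exists v.2; split; first exact: (W_proj dP FP lam0 Wv).2.
  by exists v'.2; first exact: (W_proj dP FP lam0 Wv').2.
by exists f; split => // i j; rewrite escale3; exact: fd.
Qed.

Lemma Lipschitz_selection_W_condition (R : realType) (M : Type)
    (rho : M -> M -> \bar R) (F : M -> set (plane R)) (lam : R)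
    (f : M -> plane R) :
  is_pseudometric rho -> 0 <= lam -> is_selection F f ->
  (forall x y, (`|f x - f y|%:E <= escale lam (rho x y))%E) ->
  W_condition rho F lam.
Proof.
move=> [d0 _ dsym _] lam0 Ff flip.
have fW x x' x'' : W rho F lam x x' x'' (f x).
  apply: subset_rect_hull; rewrite !minkowski_sum_scaleQ0; try exact: escale_ge0.
  by split; [exists (f x')|exists (f x'')] => //; rewrite dsym.
move=> x x' x'' y y' y''; exists (f x); split => //.
by rewrite minkowski_sum_scaleQ0; [exists (f y)|exact: escale_ge0].
Qed.

(** * From finite to infinite domains *)

(** A point v far away in the larger intersection is joined to a by a segment;
    where it crosses a fixed sphere around a, it lies in the thickenings of
    radius al + epsilon, with epsilon small as v is far.  A limit of such
    crossings is in the smaller intersection, on a sphere too large for it. *)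
Lemma bounded_thicken (R : realType) (I : Type) (K : I -> set (plane R))
    (al be B : R) (a : plane R) :
  (forall k, Conv (K k)) -> (forall k, thicken (K k) al%:E a) ->
  (forall v, (forall k, thicken (K k) al%:E v) -> `|v| <= B) ->
  exists B', forall v, (forall k, thicken (K k) be%:E v) -> `|v| <= B'.
Proof.
move=> KP Ka KB; apply: contrapT => /forallNP unbounded.
have aB := KB _ Ka; have B0 : 0 <= B := le_trans (normr_ge0 _) aB.
(* A point at distance s from a has norm at least s - |a| > B. *)
pose s := `|a| + B + 1.
have s0 : 0 < s by rewrite ltr_wpDl // addr_ge0.
have /choice[z zP] n : exists z : plane R, `|a - z| = s /\
    forall k, thicken (K k) (al + n.+1%:R^-1)%:E z.
  have /existsNP[v /not_implyP[Kv /negP]] :=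
    unbounded (`|a| + s + s * `|be - al| * n.+1%:R).
  rewrite -ltNge => vlarge.
  have e0 : 0 <= s * `|be - al| * n.+1%:R by rewrite !mulr_ge0 // ltW.
  have nva : s + s * `|be - al| * n.+1%:R <= `|v - a|.
    rewrite -(lerD2r `|a|); apply: le_trans (_ : `|v| <= _).
      by rewrite ltW // (le_lt_trans _ vlarge) // addrAC [s + _]addrC.
    by rewrite -{1}[v](subrK a) ler_normD.
  have va0 : 0 < `|v - a| by apply: lt_le_trans nva; rewrite ltr_pwDl.
  (* Parameter at which the segment from a to v crosses the sphere. *)
  pose t := s / `|v - a|.
  have t0 : 0 <= t by rewrite divr_ge0 // ltW.
  have t1 : t <= 1.
    by rewrite ler_pdivrMr // mul1r (le_trans _ nva) // lerDl.
  exists (t *: v + (1 - t) *: a); split.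
    have -> : a - (t *: v + (1 - t) *: a) = t *: (a - v).
      by rewrite scalerBl scale1r addrCA opprD addrA subrr add0r opprB scalerBr.
    by rewrite normrZ ger0_norm // distrC divfK // gt_eqF.
  move=> k; apply: subset_thicken (thicken_segment _ (Ka k) (Kv k) t0 t1).
    rewrite lee_fin.
    have -> : t * be + (1 - t) * al = al + t * (be - al) by ring.
    rewrite lerD2l (le_trans (ler_norm _)) // normrM (ger0_norm t0).
    rewrite /t mulrAC ler_pdivrMr // ler_pdivlMl ?ltr0n // mulrC.
    by rewrite (le_trans _ nva) // lerDr ltW.
  by have [] := KP k.
pose S := [set x : plane R | `|a - x| <= s] `&` [set x : plane R | s <= `|a - x|].
have cS : compact S.
  apply: compact_closedI; first exact: compact_plane_ball.
  apply: (@preimage_closed (plane R) R^o (fun x => `|a - x|) [set y | s <= y]).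
    move=> x _; apply: cvg_norm; apply: cvgB; [exact: cvg_cst|exact: cvg_id].
  exact: closed_ge.
have [|x [[_ /= xs] xcl]] := cS (z @ \oo) _.
  by exists 0%N => // n _; have [zs _] := zP n; rewrite /S /= zs lexx.
rewrite clusterE in xcl.
have Kx k : thicken (K k) al%:E x.
  have [K0 _ clK] := KP k; apply: thicken_limit => // e e0.
  apply: (closed_thicken clK K0); apply: xcl.
  suff : \forall n \near \oo, thicken (K k) (al + e)%:E (z n) by [].
  near=> n; have [_ /(_ k)] := zP n; apply: subset_thicken.
  rewrite lee_fin lerD2l; apply: ltW; near: n.
  exact: near_infty_natSinv_lt (PosNum e0).
have := KB _ Kx; apply/negP; rewrite -ltNge.
have : s <= `|a| + `|x| by apply: le_trans xs (ler_normB _ _).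
rewrite /s; lra.
Unshelve. all: by end_near.
Qed.

Lemma compact_finite_intersections (T : topologicalType) (I : choiceType)
    (A : set T) (C : I -> set T) :
  compact A -> (forall i, closed (C i)) ->
  (forall S : {fset I}, exists2 x, A x & forall i, i \in S -> C i x) ->
  exists x, forall i, C i x.
Proof.
move=> cA clC finC.
pose G (S : {fset I}) := [set x | A x /\ forall i, i \in S -> C i x].
have FF : ProperFilter (filter_from [set: {fset I}] G).
  apply: filter_from_proper; last first.
    by move=> S _; have [x Ax Cx] := finC S; exists x.
  apply: filter_from_filter; first by exists fset0.
  move=> S S' _ _; exists (S `|` S')%fset => // x [Ax Cx].
  by split; split => // i iS; apply: Cx; rewrite inE iS ?orbT.
have [|x [_]] := cA _ FF; first by exists fset0 => // x [].
rewrite clusterE => xcl; exists x => i; apply: (clC i); apply: xcl.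
by exists [fset i]%fset => // y [_]; apply; rewrite inE.
Qed.

(** Tychonoff's theorem, with one closed condition for each pair of points: a
    finite set of pairs involves finitely many points, on which a selection is
    given, and it is extended by arbitrary points of the compact sets K x. *)
Lemma selection_of_finite_selections (R : realType) (M : Type)
    (D : M -> M -> R) (F K : M -> set (plane R)) :
  (forall x, closed (F x)) -> (forall x, compact (K x)) ->
  (forall (I : finType) (m : I -> M), exists f : I -> plane R,
     (forall i, F (m i) (f i) /\ K (m i) (f i)) /\
     forall i j, `|f i - f j| <= D (m i) (m j)) ->
  exists f : M -> plane R, is_selection F f /\
    forall x y, `|f x - f y| <= D x y.
Proof.
move=> clF cK fin.
pose X := prod_topology (fun _ : {classic M} => plane R).
pose P : set X := [set f : X | forall x, K x (f x)].
have cP : compact P by apply: (@tychonoff {classic M}) => x; exact: cK.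
pose C (xy : {classic M} * {classic M}) : set X :=
  [set f : X | F xy.1 (f xy.1)] `&`
  [set f : X | `|f xy.1 - f xy.2| <= D xy.1 xy.2].
have projc x : continuous (fun f : X => f x : plane R).
  by move=> f; exact: (@proj_continuous {classic M} (fun=> plane R) x f).
have diffc x y : continuous (fun f : X => (f x : plane R) - (f y : plane R)).
  move=> f; exact: (@cvgB _ _ _ _ _ _ _ _ _ (projc x f) (projc y f)).
have clC xy : closed (C xy).
  apply: closedI.
    apply: (@preimage_closed X (plane R) (fun f => f xy.1) (F xy.1)).
      by move=> f _; exact: (projc xy.1 f).
    exact: clF.
  apply: (@preimage_closed X R^o
    (fun f => `|(f xy.1 : plane R) - (f xy.2 : plane R)|)
    [set t | t <= D xy.1 xy.2]).
    by move=> f _; exact: (cvg_norm (diffc xy.1 xy.2 f)).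
  exact: closed_le.
have /choice[k kK] x : exists p, K x p.
  by have [f [fP _]] := fin unit (fun=> x); exists (f tt); have [] := fP tt.
suff [f fC] : exists f : X, forall xy, C xy f.
  by exists f; split=> [x|x y]; [have [] := fC (x, x)|have [] := fC (x, y)].
apply: (compact_finite_intersections cP) => // S.
pose m (i : S + S) : {classic M} :=
  match i with inl s => (val s).1 | inr s => (val s).2 end.
have [g [gP gD]] := fin _ m.
pose f x := if pselect (exists i, m i = x) is left ex then g (projT1 (cid ex))
            else k x.
have fm x : (exists i, m i = x) -> exists2 i, m i = x & f x = g i.
  by rewrite /f; case: pselect => // ex _; exists (projT1 (cid ex)); case: cid.
exists f => [x|[x y] xyS].
  have [/fm[i <- ->]|nex] := pselect (exists i, m i = x); first by case: (gP i).
  by rewrite /f; case: pselect.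
have [|i ix fx] := fm x; first by exists (inl [`xyS]%fset).
have [|j jy fy] := fm y; first by exists (inr [`xyS]%fset).
by split => /=; rewrite ?fx ?fy -?ix -?jy //; case: (gP i).
Qed.

Lemma lip_seminorm_le (R : realType) (M : Type) (rho : M -> M -> \bar R)
    (f : M -> plane R) (c : R) :
  0 <= c -> (forall x y, (`|f x - f y|%:E <= escale c (rho x y))%E) ->
  (lip_seminorm rho f <= c%:E)%E.
Proof. by move=> c0 flip; apply: ereal_inf_lbound; exists c. Qed.

Lemma finite_domain_selection (R : realType) (M : Type)
    (rho : M -> M -> \bar R) (F : M -> set (plane R)) (lam : R) :
  is_pseudometric rho -> (forall x, Conv (F x)) -> finite_set [set: M] ->
  0 <= lam -> W_condition rho F lam ->
  exists f : M -> plane R, is_selection F f /\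
    (lip_seminorm rho f <= (3 * lam)%:E)%E.
Proof.
move=> dP FP Mfin lam0 Wc.
have /finite_seqP[s sE] : finite_set [set: {classic M}] by [].
have ins x : x \in s by have : [set: {classic M}] x by []; rewrite sE.
have [f [Ff flip]] := W_condition_finite_selection
  (fun i : seq_sub s => val i : M) dP FP lam0 Wc.
exists (fun x => f (SeqSub (ins x))); split=> [x|].
  exact: Ff (SeqSub (ins x)).
apply: lip_seminorm_le; first by rewrite mulr_ge0.
by move=> x y; exact: flip (SeqSub (ins x)) (SeqSub (ins y)).
Qed.

Lemma bounded_intersection_selection (R : realType) (M : Type)
    (rho : M -> M -> \bar R) (F : M -> set (plane R)) (lam : R) :
  is_pseudometric rho -> (forall x, Conv (F x)) ->
  bounded_intersection F -> (forall x y, (rho x y < +oo)%E) ->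
  0 <= lam -> W_condition rho F lam ->
  exists f : M -> plane R, is_selection F f /\
    (lip_seminorm rho f <= (3 * lam)%:E)%E.
Proof.
move=> dP FP [al [n [xbar [al0 [a Aa] Abnd]]]] rhofin lam0 Wc.
have l3 : 0 <= 3 * lam by rewrite mulr_ge0.
have [d0 drefl dsym dtri] := dP.
pose D x y : R := 3 * lam * fine (rho x y).
have DE x y : (D x y)%:E = escale (3 * lam) (rho x y).
  rewrite /escale lt_eqF // /D EFinM fineK // ge0_fin_numE //.
have D0 x y : 0 <= D x y by rewrite mulr_ge0 // fine_ge0.
have thickA v : (forall k, thicken (F (xbar k)) al%:E v) ->
    (\bigcap_(k in [set: 'I_n])
       minkowski_sum (F (xbar k)) (scaleQ0 al%:E)) v.
  by move=> Fv k _; rewrite minkowski_sum_scaleQ0 // lee_fin.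
have [B [_ AB]] := Abnd.
have {}AB v : (forall k, thicken (F (xbar k)) al%:E v) -> `|v| <= B + 1.
  by move=> Fv; apply: (AB (B + 1)); [rewrite ltrDl|exact: thickA].
have {}Aa k : thicken (F (xbar k)) al%:E a.
  by rewrite -minkowski_sum_scaleQ0 ?lee_fin //; exact: Aa.
pose K x : set (plane R) :=
  [set v | forall k, thicken (F (xbar k)) (D (xbar k) x)%:E v].
have cK x : compact (K x).
  have [B' KB'] := bounded_thicken (\sum_k D (xbar k) x)
    (fun k => FP (xbar k)) Aa AB.
  apply: (@subclosed_compact _ _ [set s : plane R | `|0 - s| <= B']).
  - have -> : K x = \bigcap_(k in [set: 'I_n])
        thicken (F (xbar k)) (D (xbar k) x)%:E.
      by apply/seteqP; split=> v /= Kv k; [move=> _|]; exact: Kv.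
    by apply: closed_bigI => k _; apply: closed_thicken; have [] := FP (xbar k).
  - exact: compact_plane_ball.
  - move=> v Kv; rewrite /= sub0r normrN; apply: KB' => k.
    apply: subset_thicken (Kv k).
    by rewrite lee_fin (bigD1 k) //= lerDl sumr_ge0.
have [||f [Ff fD]] := @selection_of_finite_selections R M D F K _ cK.
- by move=> x; have [] := FP x.
- move=> I m.
  (* Adding the points xbar k to the family confines the values to K. *)
  pose m' (i : I + 'I_n) := match i with inl i => m i | inr k => xbar k end.
  have [f [Ff flip]] := W_condition_finite_selection m' dP FP lam0 Wc.
  exists (f \o inl); split=> [i|i j].
    split; first exact: Ff (inl i).
    move=> k; exists (f (inr k)); first exact: Ff (inr k).
    by rewrite DE dsym; exact: (flip (inl i) (inr k)).
  by rewrite -lee_fin DE; exact: (flip (inl i) (inl j)).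
exists f; split => //; apply: lip_seminorm_le => // x y.
by rewrite -DE lee_fin.
Qed.

Theorem theorem5p4 (R : realType) (M : Type) (rho : M -> M -> \bar R)
    (F : M -> set (plane R)) :
  is_pseudometric rho ->
  (forall x, Conv (F x)) ->
  (finite_set [set: M] \/
   bounded_intersection F /\ (forall x y, (rho x y < +oo)%E)) ->
  ((exists f : M -> plane R, is_Lipschitz rho f /\ is_selection F f) <->
   (exists lam : R, 0 <= lam /\ W_condition rho F lam)) /\
  (let inf_lam :=
     ereal_inf [set lam%:E | lam in
                  [set lam : R | (0 <= lam)%R /\ W_condition rho F lam]] in
   inf_lam <= selection_norm rho F <= 3%:E * inf_lam)%E.
Proof.
move=> dP FP Mfin.
have sel lam : 0 <= lam -> W_condition rho F lam ->
    exists f : M -> plane R, is_selection F f /\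
      (lip_seminorm rho f <= (3 * lam)%:E)%E.
  case: Mfin => [Mfin|[Fbnd rhofin]].
    exact: finite_domain_selection.
  exact: bounded_intersection_selection.
split; first split.
- move=> [f [fL Ff]]; have [_ [lam [lam0 flip] <-] _] := ereal_inf_lt fL.
  by exists lam; split => //; exact: Lipschitz_selection_W_condition flip.
- move=> [lam [lam0 Wc]]; have [f [Ff fL]] := sel _ lam0 Wc.
  by exists f; split => //; rewrite /is_Lipschitz (le_lt_trans fL) // ltry.
move=> inf_lam; apply/andP; split.
  apply: le_ereal_inf_tmp => _ [f [_ Ff] <-].
  apply: le_ereal_inf_tmp => _ [lam [lam0 flip] <-].
  apply: ereal_inf_lbound; exists lam => //; split => //.
  exact: Lipschitz_selection_W_condition flip.
rewrite -ereal_inf_pZl //; apply: le_ereal_inf_tmp.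
move=> _ [_ [lam [lam0 Wc] <-] <-].
have [f [Ff fL]] := sel _ lam0 Wc; apply: (le_trans _ fL).
apply: ereal_inf_lbound; exists f => //; split => //.
by rewrite /is_Lipschitz (le_lt_trans fL) // ltry.
Qed.
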